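(* Let $K$ be a field and let $A$ be a finitely generated (associative, unital) $K$-algebra that is a domain of finite Gelfand-Kirillov dimension. Let $Q(A)$ denote the quotient division algebra of $A$ and let $Z(Q(A))$ denote its centre. If $a\in A$ is not algebraic over $Z(Q(A))$, then $$\mathrm{GKdim}(C(a;A))\le \mathrm{GKdim}(A)-1,$$ where $C(a;A)$ denotes the centralizer of $a$ in $A$ and Gelfand-Kirillov dimensions are taken over $K$.
   Context: Domains are not assumed commutative. For a finitely generated $K$-algebra $A$, the Gelfand-Kirillov dimension is $$\mathrm{GKdim}(A)=\limsup_{n\to\infty}\frac{\log(\dim_K V^n)}{\log n},$$ where $V$ is a finite-dimensional $K$-subspace of $A$ containing $1$ that generates $A$ as a $K$-algebra, and $V^n$ is the $K$-span of all products of $n$ elements of $V$; this is independent of the choice of $V$. If a $K$-algebra is not finitely generated, its GK dimension is the supremum of the GK dimensions of its finitely generated subalgebras. A domain $A$ of finite GK dimension is an Ore domain, so it has a quotient division algebra $Q(A)$ (its Ore localization at the nonzero elements). The centre $Z(Q(A))$ is a field containing $K$, called the extended centre of $A$. An element $a\in A$ is algebraic over $Z(Q(A))$ if it is a root of a nonzero polynomial with coefficients in $Z(Q(A))$. For a ring $R$ and $a\in R$, $C(a;R)=\{r\in R: ra=ar\}$ is the centralizer of $a$ in $R$. *)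

(* Defs.v *)
From HB Require Import structures.
From mathcomp Require Import all_boot all_order all_algebra.
From mathcomp Require Import all_classical all_reals all_analysis.

Set Implicit Arguments.
Unset Strict Implicit.
Unset Printing Implicit Defensive.

Import Order.TTheory GRing.Theory Num.Theory.
Local Open Scope classical_set_scope.
Local Open Scope ring_scope.

Section Subspaces.
Variables (K : fieldType) (E : lmodType K).
Implicit Types X W : set E.

Definition lspan X : set E :=
  smallest [set W : set E | GRing.submod_closed (mem W)] X.

Definition lin_indep (d : nat) (b : 'I_d -> E) : Prop :=
  forall c : 'I_d -> K, \sum_(i < d) c i *: b i = 0 -> forall i, c i = 0.

Definition has_dim W (d : nat) : Prop :=
  exists b : 'I_d -> E, lin_indep b /\ W = lspan (range b).

Definition fin_dim W : Prop := exists d, has_dim W d.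

(* Equals 0 when W is not a finite-dimensional subspace. *)
Definition ldim W : nat := xget 0%N [set d | has_dim W d].

End Subspaces.

Section GKdim.
Variables (R : realType) (K : fieldType) (A : algType K).
Implicit Types B C V : set A.

Definition subalgebra B : Prop := GRing.subalg_closed (mem B).

Definition subspace_exp V (n : nat) : set A :=
  lspan [set \prod_(i < n) f i | f in [set f : 'I_n -> A | forall i, V (f i)]].

Definition generating_subspace V B : Prop :=
  [/\ fin_dim V, V 1 & smallest subalgebra V = B].

Definition fin_gen B : Prop := exists V, generating_subspace V B.

(* The terms n = 0 and n = 1 are junk, and are irrelevant to the limsup. *)
Definition growth_exponent V : \bar R :=
  limn_esup (fun n => (ln (ldim (subspace_exp V n))%:R / ln n%:R)%:E).

(* The value does not depend on V, so this chooses from a singleton whenever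
   B is finitely generated. *)
Definition GKdim_fg B : \bar R :=
  xget 0%E [set growth_exponent V | V in [set V | generating_subspace V B]].

(* B is a subalgebra of A, and its dimension is computed inside A. *)
Definition GKdim B : \bar R :=
  if `[< fin_gen B >] then GKdim_fg B
  else ereal_sup [set GKdim_fg C | C in [set C | fin_gen C /\ C `<=` B]].

End GKdim.

Definition domain (A : nzRingType) : Prop :=
  forall x y : A, x * y = 0 -> x = 0 \/ y = 0.

Definition centralizer (A : nzRingType) (a : A) : set A :=
  [set r | r * a = a * r].

Definition center (A : nzRingType) : set A :=
  [set z | forall r : A, z * r = r * z].

(* The coefficients of p are central, so p.[x] does not depend on the side on
   which they are written. *)
Definition algebraic_over_center (Q : nzRingType) (x : Q) : Prop :=
  exists p : {poly Q}, [/\ p != 0, forall i, center p`_i & p.[x] = 0].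

(* Q, with iota, is the Ore localization of A at its nonzero elements, which
   these properties determine up to a unique isomorphism over A. Right
   fractions are enough: when A is also left Ore, left fractions follow. *)
Definition quotient_division_algebra (K : fieldType) (A : algType K)
    (Q : unitAlgType K) (iota : {lrmorphism A -> Q}) : Prop :=
  [/\ forall q : Q, q != 0 -> q \is a GRing.unit,
      injective iota
    & forall q : Q, exists r s : A, s != 0 /\ q = iota r / iota s].

(* Main.v *)
(* Let F be the centralizer of a in Q, and let V be a generating subspace of A.

   If A lay in a finite left F-span of elements e_1, ..., e_n of Q, then the n
   equations sum_i a^i e_j q_i = 0 in the n + 1 unknowns q_0, ..., q_n would
   have a nonzero solution, and sum_i a^i x q_i = 0 for all x in A because a
   commutes with F. A relation of minimal support of this kind has central
   coefficients up to scaling, so a would be algebraic over the centre of Q.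

   Hence V^n contains n + 1 elements that are left independent over F. If W is
   a finite-dimensional subspace of the centralizer of a in A and W is contained
   in V^m, the products of these elements with a basis of W^n are independent
   over K, so (n + 1) dim W^n <= dim V^((m + 1) n). Taking logarithms gives the
   bound. *)
Require Import Defs.
From HB Require Import structures.
From mathcomp Require Import all_boot all_order all_algebra.
From mathcomp Require Import all_classical all_reals all_analysis.
From mathcomp Require Import zify lra.

Set Implicit Arguments.
Unset Strict Implicit.
Unset Printing Implicit Defensive.

Import Order.TTheory GRing.Theory Num.Theory.
Local Open Scope classical_set_scope.
Local Open Scope ring_scope.

(** * Linear spans, bases and dimension *)

Section Span.
Variables (K : fieldType) (E : lmodType K).
Implicit Types X W : set E.

Lemma submodP W : GRing.submod_closed (mem W) <->
  W 0 /\ forall c u v, W u -> W v -> W (c *: u + v).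
Proof.
split=> [[W0 WD]|[W0 WD]]; split=> //.
- by move: W0; rewrite inE.
- by move=> c u v Wu Wv; have := WD c u v; rewrite !inE; apply.
- by rewrite inE.
- by move=> c u v; rewrite !inE; apply: WD.
Qed.

Lemma sub_lspan X : X `<=` lspan X.
Proof. exact: sub_gen_smallest. Qed.

Lemma lspan_min X W : GRing.submod_closed (mem W) -> X `<=` W -> lspan X `<=` W.
Proof. exact: smallest_sub. Qed.

Lemma lspan_submod X : GRing.submod_closed (mem (lspan X)).
Proof.
apply/submodP; split=> [W [/submodP[]]//|c u v Xu Xv W [Wsub XW]].
by have /submodP[_] := Wsub; apply; [exact: Xu|exact: Xv].
Qed.

Lemma lspan_ind X (P : E -> Prop) : P 0 ->
  (forall c u v, P u -> P v -> P (c *: u + v)) -> (forall x, X x -> P x) ->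
  forall x, lspan X x -> P x.
Proof. by move=> P0 PD XP; apply: lspan_min => //; exact/submodP. Qed.

Lemma lspan0 X : lspan X 0.
Proof. by have /submodP[] := lspan_submod X. Qed.

Lemma lspanZD X c u v : lspan X u -> lspan X v -> lspan X (c *: u + v).
Proof. by have /submodP[_] := lspan_submod X; apply. Qed.

Lemma lspan_sum X (I : finType) (c : I -> K) (e : I -> E) :
  (forall i, lspan X (e i)) -> lspan X (\sum_i c i *: e i).
Proof.
move=> Xe; elim/big_ind: _ => [|u v Xu Xv|i _].
- exact: lspan0.
- by rewrite -[u]scale1r; exact: lspanZD.
- by rewrite -[_ *: _]addr0; apply: lspanZD => //; exact: lspan0.
Qed.

Lemma lspan_rangeP (I : finType) (e : I -> E) x :
  lspan (range e) x <-> exists c : I -> K, x = \sum_i c i *: e i.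
Proof.
split=> [|[c ->]]; last first.
  by apply: lspan_sum => i; apply: sub_lspan; exists i.
move: x; apply: lspan_min => [|_ [i _ <-]].
  apply/submodP; split.
    by exists (fun=> 0); rewrite big1// => i _; rewrite scale0r.
  move=> c _ _ [a ->] [b ->]; exists (fun i => c * a i + b i).
  rewrite scaler_sumr -big_split/=; apply: eq_bigr => i _.
  by rewrite scalerDl scalerA.
exists (fun j => (j == i)%:R); rewrite (bigD1 i)//= eqxx scale1r big1 ?addr0//.
by move=> j /negbTE ->; rewrite scale0r.
Qed.

Lemma lin_indep_le_span (d k : nat) (b : 'I_d -> E) (e : 'I_k -> E) :
  lin_indep b -> (forall i, lspan (range e) (b i)) -> (d <= k)%N.
Proof.
move=> b_free b_span; rewrite leqNgt; apply/negP => lt_kd.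
have [m bE] := choice (fun i => (lspan_rangeP e (b i)).1 (b_span i)).
pose M : 'M[K]_(d, k) := \matrix_(i, j) m i j.
(* With more rows than columns, the coordinate matrix kills a nonzero row vector, which is a linear
   dependence among the [b i]. *)
have /rowV0Pn[v /sub_kermxP vM0 v0] : kermx M != 0.
  rewrite -mxrank_eq0 mxrank_ker subn_eq0 -ltnNge.
  exact: leq_ltn_trans (rank_leq_col _) lt_kd.
case/negP: v0; apply/eqP/rowP => i; rewrite mxE.
apply: (b_free (fun i => v 0 i)).
transitivity (\sum_(j < k) (v *m M) 0 j *: e j); last first.
  by rewrite vM0 big1// => j _; rewrite mxE scale0r.
under eq_bigr do rewrite bE scaler_sumr.
rewrite exchange_big/=; apply: eq_bigr => j _.
rewrite mxE scaler_suml; apply: eq_bigr => l _.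
by rewrite mxE scalerA.
Qed.

(** A basis is extracted by discarding, one at a time, a vector that has a nonzero coefficient in a
    linear relation. *)
Lemma has_dim_range (k : nat) (e : 'I_k -> E) : fin_dim (lspan (range e)).
Proof.
elim: k e => [|k IHk] e; first by exists 0%N, e; split=> // c _ [].
have [e_free|] := pselect (lin_indep e); first by exists k.+1, e.
move=> /existsNP[c /not_implyP[ce0 /existsNP[i /eqP ci0]]].
suff -> : lspan (range e) = lspan (range (e \o lift i)) by exact: IHk.
apply/seteqP; split; apply: lspan_min; try exact: lspan_submod.
  move=> _ [j _ <-]; case: (unliftP i j) => [j' ->|->].
    by apply: sub_lspan; exists j'.
  have -> : e i = \sum_(j < k) (- (c i)^-1 * c (lift i j)) *: (e \o lift i) j.
    move: ce0; rewrite (bigD1_ord i)//= => /(canRL (addrK _)).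
    rewrite sub0r => /(congr1 (fun x => (c i)^-1 *: x)).
    rewrite scalerA mulVf// scale1r => ->.
    rewrite scalerN -scaleNr scaler_sumr; apply: eq_bigr => l _.
    by rewrite scalerA.
  by apply: lspan_sum => l; apply: sub_lspan; exists l.
by move=> _ [l _ <-]; apply: sub_lspan; exists (lift i l).
Qed.

Lemma fin_dim_range (I : finType) (e : I -> E) : fin_dim (lspan (range e)).
Proof.
suff -> : range e = range (e \o (@enum_val I I)) by exact: has_dim_range.
apply/seteqP; split=> _ [i _ <-]; last by exists (enum_val i).
by exists (enum_rank i) => //=; rewrite enum_rankK.
Qed.

Lemma ldimP W : fin_dim W -> has_dim W (ldim W).
Proof. exact: (@xgetPex _ 0%N [set d | has_dim W d]). Qed.

(** The index type is arbitrary so that families of products can be indexed by pairs. *)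
Lemma card_le_ldim (I : finType) (b : I -> E) W : fin_dim W ->
  (forall c : I -> K, \sum_i c i *: b i = 0 -> forall i, c i = 0) ->
  (forall i, W (b i)) -> (#|I| <= ldim W)%N.
Proof.
move=> /ldimP[e [_ WE]] b_free Wb.
apply: (@lin_indep_le_span _ _ (b \o enum_val) e) => [c cb0 i|i]; last first.
  by rewrite -WE; exact: Wb.
rewrite -(enum_valK i); apply: (b_free (c \o enum_rank)).
rewrite (reindex (@enum_val I I)) /=; last first.
  by exists enum_rank => x _; rewrite ?enum_valK ?enum_rankK.
by rewrite -[RHS]cb0; apply: eq_bigr => j _ /=; rewrite enum_valK.
Qed.

End Span.

(** * Powers of a subspace and the subalgebra they exhaust *)

Section SubspaceExp.
Variables (K : fieldType) (A : algType K).
Implicit Types V W : set A.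

Lemma subalgebraP W : subalgebra W <->
  [/\ W 1, forall c u v, W u -> W v -> W (c *: u + v)
    & forall u v, W u -> W v -> W (u * v)].
Proof.
split=> [[W1 WD WM]|[W1 WD WM]]; split.
- by move: W1; rewrite inE.
- by move=> c u v Wu Wv; have := WD c u v; rewrite !inE; apply.
- by move=> u v Wu Wv; have := WM u v; rewrite !inE; apply.
- by rewrite inE.
- by move=> c u v; rewrite !inE; apply: WD.
- by move=> u v; rewrite !inE; apply: WM.
Qed.

Lemma subalgebra_submod W : subalgebra W -> GRing.submod_closed (mem W).
Proof. exact: GRing.subalg_closedZ. Qed.

Lemma subspace_exp_prod V n (f : 'I_n -> A) :
  (forall i, V (f i)) -> subspace_exp V n (\prod_i f i).
Proof. by move=> Vf; apply: sub_lspan; exists f. Qed.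

Lemma subspace_exp1 V : V `<=` subspace_exp V 1.
Proof.
by move=> v Vv; have := @subspace_exp_prod V 1 (fun=> v); rewrite big_ord1; apply.
Qed.

Lemma mem1_subspace_exp V n : V 1 -> subspace_exp V n 1.
Proof.
by move=> V1; have := @subspace_exp_prod V n (fun=> 1); rewrite big1//; apply.
Qed.

Lemma subspace_expM V m n x y :
  subspace_exp V m x -> subspace_exp V n y -> subspace_exp V (m + n) (x * y).
Proof.
have [Vmn0 VmnD] := (submodP _).1 (lspan_submod _ : GRing.submod_closed
  (mem (subspace_exp V (m + n)))).
move=> Vx Vy; elim/lspan_ind: Vy => [|c u v|_ [g Vg <-]]; first by rewrite mulr0.
  by rewrite mulrDr -scalerAr; exact: VmnD.
elim/lspan_ind: Vx => [|c u v|_ [f Vf <-]]; first by rewrite mul0r.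
  by rewrite mulrDl -scalerAl; exact: VmnD.
pose h (i : 'I_(m + n)) :=
  match fintype.split i with inl j => f j | inr j => g j end.
have -> : \prod_i f i * \prod_i g i = \prod_i h i.
  rewrite big_split_ord; congr (_ * _); apply: eq_bigr => i _; rewrite /h.
    by case: split_ordP => j /eqP; rewrite ?eq_lshift ?eq_lrshift// => /eqP ->.
  by case: split_ordP => j /eqP; rewrite ?eq_rshift ?eq_rlshift// => /eqP ->.
apply: subspace_exp_prod => i; rewrite /h.
by case: fintype.split => j; [exact: Vf|exact: Vg].
Qed.

Lemma subspace_exp_mono V m n : V 1 -> (m <= n)%N ->
  subspace_exp V m `<=` subspace_exp V n.
Proof.
move=> V1 le_mn x Vx; rewrite -(subnKC le_mn) -[x]mulr1.
by apply: subspace_expM => //; exact: mem1_subspace_exp.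
Qed.

Lemma subspace_exp_exp V W m n : W `<=` subspace_exp V m ->
  subspace_exp W n `<=` subspace_exp V (m * n).
Proof.
move=> WV; apply: lspan_min => [|_ [f Wf <-]]; first exact: lspan_submod.
elim: n f Wf => [|n IHn] f Wf.
  by rewrite muln0; apply: subspace_exp_prod => -[].
rewrite big_ord_recl mulnS; apply: subspace_expM; first exact: WV.
by apply: IHn => i; exact: Wf.
Qed.

Lemma subspace_exp_sub V W n : subalgebra W -> V `<=` W ->
  subspace_exp V n `<=` W.
Proof.
move=> W_alg VW; have /subalgebraP[W1 _ WM] := W_alg.
apply: lspan_min => [|_ [f Vf <-]]; first exact: subalgebra_submod.
by elim/big_ind: _ => // i _; exact: VW.
Qed.

(** Distributing a product of [n] linear combinations of the [e i] leaves only the finitely many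
    words of length [n] in them. *)
Lemma fin_dim_subspace_exp V n : fin_dim V -> fin_dim (subspace_exp V n).
Proof.
move=> [d [e [_ ->]]].
suff -> : subspace_exp (lspan (range e)) n =
    lspan (range (fun h : {ffun 'I_n -> 'I_d} => \prod_i e (h i))).
  exact: fin_dim_range.
apply/seteqP; split; (apply: lspan_min; first exact: lspan_submod).
  move=> _ [f fe <-].
  have [c fE] := choice (fun i => (lspan_rangeP e (f i)).1 (fe i)).
  under eq_bigr do rewrite fE.
  apply/lspan_rangeP; exists (fun h : {ffun 'I_n -> 'I_d} => \prod_i c i (h i)).
  rewrite bigA_distr_bigA/=; apply: eq_bigr => h _.
  by rewrite scaler_prod.
move=> _ [h _ <-]; apply: subspace_exp_prod => i.
by apply: sub_lspan; exists (h i).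
Qed.

(** Since [V] contains 1, its powers form an increasing chain, so their union is closed under sums
    as well as products. *)
Lemma generating_subspace_exp V B : generating_subspace V B ->
  B = \bigcup_n subspace_exp V n.
Proof.
move=> [_ V1 <-]; apply/seteqP; split.
  apply: smallest_sub => [|v Vv]; last by exists 1%N => //; exact: subspace_exp1.
  apply/subalgebraP; split; first by exists 0%N => //; exact: mem1_subspace_exp.
    move=> c u v [m _ Vu] [n _ Vv]; exists (maxn m n) => //.
    by apply: lspanZD; [apply: subspace_exp_mono Vu|apply: subspace_exp_mono Vv];
      rewrite ?leq_maxl ?leq_maxr.
  by move=> u v [m _ Vu] [n _ Vv]; exists (m + n)%N => //; exact: subspace_expM.
move=> x [n _ Vx] W [W_alg VW]; exact: subspace_exp_sub Vx.
Qed.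

Lemma generating_subspace_sub V B : generating_subspace V B -> V `<=` B.
Proof. by move=> [_ _ <-]; exact: sub_gen_smallest. Qed.

Lemma subspace_exp_absorb V W : fin_dim W -> V 1 ->
  W `<=` \bigcup_n subspace_exp V n ->
  exists m, W `<=` subspace_exp V m.
Proof.
move=> [d [e [_ WE]]] V1 WV.
have We i : W (e i) by rewrite WE; apply: sub_lspan; exists i.
have Ve i : exists n, subspace_exp V n (e i).
  by have [n _ Vn] := WV _ (We i); exists n.
have [m Vm] := choice Ve.
exists (\max_i m i)%N; rewrite WE; apply: lspan_min; first exact: lspan_submod.
by move=> _ [i _ <-]; apply: subspace_exp_mono (Vm i); rewrite ?leq_bigmax.
Qed.

End SubspaceExp.

(** * Linear relations over a division algebra and algebraicity *)

Lemma overdetermined_system_kernel (D : unitRingType) (n : nat)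
    (M : 'I_n -> 'I_n.+1 -> D) :
  (forall x : D, x != 0 -> x \is a GRing.unit) ->
  exists q : 'I_n.+1 -> D,
    (exists i, q i != 0) /\ forall j, \sum_i M j i * q i = 0.
Proof.
move=> D_div; elim: n M => [|n IHn] M.
  by exists (fun=> 1); split=> [|[]//]; exists ord0; exact: oner_neq0.
(* Gaussian elimination: [i] is a pivot column for the first equation, or any column when that
   equation is trivial. *)
have [i Mi] : exists i, M ord0 i != 0 \/ forall k, M ord0 k = 0.
  have [[i Mi]|/forallNP M0] := pselect (exists i, M ord0 i != 0).
    by exists i; left.
  by exists ord0; right => k; apply/eqP/negPn/negP; exact: M0.
pose s k := (M ord0 i)^-1 * M ord0 (lift i k).
have [q' [[k0 q'k0] Mq']] := IHn (fun j k =>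
  M (lift ord0 j) (lift i k) - M (lift ord0 j) i * s k).
(* The pivot unknown is read off from the first equation. The other equations reduce to the smaller
   system whatever [s] is. *)
pose q l := if unlift i l is Some k then q' k else - \sum_k s k * q' k.
have qi : q i = - \sum_k s k * q' k by rewrite /q unlift_none.
have ql k : q (lift i k) = q' k by rewrite /q liftK.
exists q; split=> [|j]; first by exists (lift i k0); rewrite ql.
rewrite (bigD1_ord i)//= qi; under eq_bigr do rewrite ql.
case: (unliftP ord0 j) => [j' ->|->]; last first.
  case: Mi => [Mi|M0].
    rewrite mulrN mulr_sumr; apply/eqP; rewrite addrC subr_eq0; apply/eqP.
    by apply: eq_bigr => k _; rewrite /s !mulrA divrr ?mul1r// D_div.
  by rewrite M0 mul0r add0r big1// => k _; rewrite M0 mul0r.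
rewrite -[RHS](Mq' j') mulrN mulr_sumr addrC -sumrB.
by apply: eq_bigr => k _; rewrite mulrBl mulrA.
Qed.
Section FiniteOverCentralizer.
Variables (K : fieldType) (A : algType K) (Q : unitAlgType K).
Variables (iota : {lrmorphism A -> Q}).
Hypothesis Q_quotient : quotient_division_algebra iota.
Variable a : Q.

(* In a relation of minimal support, normalized to have a coefficient 1, the
   commutator of the coefficients with iota r gives a shorter relation, hence
   vanishes: the coefficients are central. *)
Lemma algebraic_of_relation (n : nat) (q : 'I_n -> Q) :
  (exists i, q i != 0) ->
  (forall x, \sum_(i < n) a ^+ i * iota x * q i = 0) ->
  algebraic_over_center a.
Proof.
have [Q_div _ Q_frac] := Q_quotient.
have [m le_qm] := ubnP #|[pred i | q i != 0]|.
elim: m q le_qm => // m IHm q le_qm [i0 qi0] q_rel.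
have [q' q'E] : {q' : 'I_n -> Q | forall i, q' i = q i / q i0} by exists (fun i => q i / q i0).
have q'_rel x : \sum_(i < n) a ^+ i * iota x * q' i = 0.
  under eq_bigr do rewrite q'E mulrA.
  by rewrite -mulr_suml q_rel mul0r.
have q'1 : q' i0 = 1 by rewrite q'E divrr// Q_div.
have [[r [i1 qi1]]|/forallNP q'_comm] :=
    pselect (exists r i, iota r * q' i - q' i * iota r != 0).
  apply: (IHm (fun i => iota r * q' i - q' i * iota r)) => [||x].
  (* Zero coefficients stay zero, and the coefficient at [i0] becomes zero because [q' i0 = 1]. *)
  - apply: leq_trans (_ : (#|[pred i | q i != 0%R]| <= m)%N); last by [].
    apply: proper_card; apply/properP; split.
      apply/fintype.subsetP => i; rewrite !inE; apply: contraNneq => qi.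
      by rewrite q'E qi mul0r mulr0 mul0r subrr.
    by exists i0; rewrite ?inE// q'1 mulr1 mul1r subrr eqxx.
  - by exists i1.
  (* The first half is the relation at [x * r]; the second is the relation at [x], multiplied on the
     right by [iota r]. *)
  under eq_bigr do rewrite mulrBr 2!mulrA.
  rewrite sumrB -mulr_suml q'_rel mul0r subr0.
  under eq_bigr do rewrite -(mulrA (a ^+ _)) -rmorphM.
  exact: q'_rel.
have q'A r i : iota r * q' i = q' i * iota r.
  apply/eqP; rewrite -subr_eq0; apply/negPn/negP => ri.
  by apply: (q'_comm r); exists i.
(* Commuting with the image of [A] extends to fractions by cancelling the denominator. *)
have q'Z i : Defs.center (q' i).
  move=> x; have [r [s [s0 ->]]] := Q_frac x.
  have s_unit : iota s \is a GRing.unit.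
    apply: Q_div; rewrite -(rmorph0 iota); apply: contra_neq s0.
    by have [_ + _] := Q_quotient; apply.
  apply: (mulIr s_unit); rewrite -[RHS]mulrA -q'A.
  by rewrite !mulrA !divrK// q'A.
pose c i := oapp q' 0 (insub i).
have cE (i : 'I_n) : c i = q' i by rewrite /c valK.
exists (\poly_(i < n) c i); split.
- apply/eqP => /(congr1 (fun p : {poly Q} => p`_i0)).
  by rewrite coef_poly ltn_ord cE q'1 coef0 => /eqP; rewrite oner_eq0.
- move=> i; rewrite coef_poly /c.
  case: ifP => _; last by move=> x; rewrite mulr0 mul0r.
  by case: insub => [j|] /=; [exact: q'Z|move=> x; rewrite mulr0 mul0r].
(* Evaluation puts the coefficients on the left of the powers and the relation at 1 puts them on the
   right; centrality reconciles the two. *)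
- rewrite horner_poly -[RHS](q'_rel 1); apply: eq_bigr => i _.
  by rewrite cE rmorph1 mulr1 q'Z.
Qed.

Lemma algebraic_of_finite_span (n : nat) (e : 'I_n -> Q) :
  (forall x, exists f : 'I_n -> Q,
     (forall i, centralizer a (f i)) /\ iota x = \sum_i f i * e i) ->
  algebraic_over_center a.
Proof.
move=> e_span; have [Q_div _ _] := Q_quotient.
have [q [q0 qe]] :=
  overdetermined_system_kernel (fun j (i : 'I_n.+1) => a ^+ i * e j) Q_div.
apply: (algebraic_of_relation q0) => x.
have [f [fC ->]] := e_span x.
under eq_bigr do rewrite mulr_sumr mulr_suml.
rewrite exchange_big big1//= => j _.
(* As [f j] commutes with each [a ^+ i], the inner sum is [f j] times the equation numbered [j]. *)
rewrite -[RHS](mulr0 (f j)) -[in RHS](qe j) mulr_sumr.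
apply: eq_bigr => i _; rewrite !mulrA; congr (_ * _ * _).
by apply/esym/commrX; exact: fC.
Qed.

End FiniteOverCentralizer.

(** * Comparison of growth exponents *)

Lemma ln_nat_unbounded (R : realType) (T : R) :
  exists N : nat, forall n, (N <= n)%N -> T <= ln n%:R.
Proof.
exists (Num.truncn (expR T)).+1 => n lt_n.
have TN : expR T < n%:R.
  by apply: (lt_le_trans (truncnS_gt _)); rewrite ler_nat.
by rewrite -[T]expRK ler_ln ?posrE ?expR_gt0 ?ltW// (lt_trans (expR_gt0 T)).
Qed.

(** With g the upper limit for [u], for large n one has ln (n + 1) + ln (v n) <= (g + e/2) (ln M +
    ln n). Dividing by ln n, the factor n + 1 accounts for the 1 subtracted, and the term in ln M
    tends to 0. *)
Lemma limn_esup_log_ratio (R : realType) (u v : nat -> nat) (M : nat) :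
  (0 < M)%N -> (forall n, 0 < v n)%N ->
  (forall n, n.+1 * v n <= u (M * n))%N ->
  (limn_esup (fun n => (ln (v n)%:R / ln n%:R : R)%:E) <=
   limn_esup (fun n => (ln (u n)%:R / ln n%:R : R)%:E) - 1)%E.
Proof.
move=> M0 v0 uv; set gu := limn_esup (fun n => (ln (u n)%:R / _)%:E).
have ln_nat_ge0 n : 0 <= ln n%:R :> R.
  by case: n => [|n]; [rewrite ln0|rewrite ln_ge0 ?ler1n].
(* This excludes the value -oo; for +oo the bound is trivial. *)
have gu0 : (0 <= gu)%E.
  apply: limf_esup_ge0 => [|n]; first exact: filter_not_empty.
  by rewrite lee_fin divr_ge0.
case guE : gu gu0 => [g| |] //= g0; last by rewrite addye ?leey.
rewrite lee_fin in g0; rewrite -EFinB.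
apply/lee_addgt0Pr => e e0.
have e2 : 0 < e / 2 by rewrite divr_gt0.
have /ereal_inf_lt[_ [B [N _ NB] <-] supB] : (gu < (g + e / 2)%:E)%E.
  by rewrite guE lte_fin ltrDl.
(* Beyond [N'], the term (g + e/2) ln M is at most (e/2) ln n. *)
have [N' N'P] := ln_nat_unbounded ((g + e / 2) * ln M%:R / (e / 2) : R).
pose N0 := (2 + N + N')%N.
apply: (@le_trans _ _ (ereal_sup ((fun n => (ln (v n)%:R / ln n%:R : R)%:E)
    @` [set n | (N0 <= n)%N]))).
  apply: ereal_inf_lbound; exists [set n | (N0 <= n)%N] => //.
  by exists N0.
apply: ge_ereal_sup => _ [n /= nN0 <-].
have [n2 nN nN'] : [/\ 1 < n, N <= n & N' <= n]%N by rewrite /N0 in nN0; split; lia.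
rewrite -EFinD lee_fin.
have ln_n : 0 < ln n%:R :> R by rewrite ln_gt0// ltr1n.
rewrite ler_pdivrMr//.
have leMn : (n <= M * n)%N by rewrite leq_pmull.
have Mn2 : (1 < M * n)%N by exact: leq_trans leMn.
have ln_Mn : 0 < ln (M * n)%:R :> R by rewrite ln_gt0// ltr1n.
have : ln (u (M * n)%N)%:R <= (g + e / 2) * ln (M * n)%:R.
  rewrite -ler_pdivrMr// -lee_fin; apply/ltW; apply: le_lt_trans supB.
  apply: ereal_sup_ubound; exists (M * n)%N => //.
  by apply: NB; exact: leq_trans leMn.
have : ln (n.+1 * v n)%:R <= ln (u (M * n)%N)%:R :> R.
  rewrite ler_ln ?posrE ?ltr0n ?ler_nat ?muln_gt0 ?v0//.
  by apply: leq_trans (uv n); rewrite muln_gt0 v0.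
have lnS : ln n%:R <= ln n.+1%:R :> R.
  by rewrite ler_ln ?posrE ?ltr0n ?ler_nat// ltnW.
have := N'P n nN'; rewrite ler_pdivrMr//.
rewrite !natrM !lnM ?posrE ?ltr0n ?v0//; last exact: ltnW.
by nra.
Qed.

(** * Elements independent over the centralizer, and the resulting growth *)

Section Growth.
Variables (K : fieldType) (A : algType K) (Q : unitAlgType K).
Variables (iota : {lrmorphism A -> Q}).
Hypothesis Q_quotient : quotient_division_algebra iota.

(** Coefficients are taken in [Q], where the centralizer is a division ring, so that a relation can
    be solved for any vector with a nonzero coefficient. *)
Definition free_over_centralizer (a : Q) (n : nat) (b : 'I_n -> A) : Prop :=
  forall f : 'I_n -> Q, (forall i, centralizer a (f i)) ->
    \sum_i f i * iota (b i) = 0 -> forall i, f i = 0.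

Lemma centralizerV (a x : Q) : x != 0 -> centralizer a x -> centralizer a x^-1.
Proof.
have [Q_div _ _] := Q_quotient; move=> /Q_div x_unit xa.
apply: (mulrI x_unit); rewrite /centralizer /= !mulrA divrr// mul1r xa.
by rewrite -mulrA divrr// mulr1.
Qed.

Lemma centralizer_subalgebra (B : algType K) (a : B) : subalgebra (centralizer a).
Proof.
apply/subalgebraP; split.
- by rewrite /centralizer /= mul1r mulr1.
- move=> c u v ua va.
  by rewrite /centralizer/= mulrDl mulrDr -scalerAl -scalerAr ua va.
- by move=> u v ua va; rewrite /centralizer/= -mulrA va !mulrA ua.
Qed.

(* If the left spans F V^n of the powers of V, with F the centralizer of a,
   stopped growing, then A would lie in a finite left F-span. *)
Lemma free_over_centralizer_exists (a : Q) (V : set A) (n : nat) :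
  generating_subspace V [set: A] -> ~ algebraic_over_center a ->
  exists b : 'I_n.+1 -> A,
    (forall i, subspace_exp V n (b i)) /\ free_over_centralizer a b.
Proof.
move=> V_gen a_tr; have [_ V1 VA] := V_gen.
have [Q_div _ _] := Q_quotient.
have /subalgebraP[F1 FD FM] := centralizer_subalgebra a.
have F0 : centralizer a 0 by rewrite /centralizer /= mul0r mulr0.
elim: n => [|n [b [bV b_free]]].
  exists (fun=> 1); split=> [i|f _]; first exact: mem1_subspace_exp.
  by rewrite big_ord1 rmorph1 mulr1 => f0 i; rewrite ord1.
have bV1 i : subspace_exp V n.+1 (b i) by exact: subspace_exp_mono (bV i).
apply/not_existsP => no_ext; apply: a_tr.
(* [S] is the part of [A] lying in the left span of the [b i] over the centralizer. *)
pose S := [set x | exists f : 'I_n.+1 -> Q,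
  (forall i, centralizer a (f i)) /\ iota x = \sum_i f i * iota (b i)].
have SD c u v : S u -> S v -> S (c *: u + v).
  move=> [f [fF fE]] [g [gF gE]]; exists (fun i => c *: f i + g i).
  split=> [i|]; first exact: FD.
  rewrite linearP /= fE gE scaler_sumr -big_split/=; apply: eq_bigr => i _.
  by rewrite mulrDl scalerAl.
(* Otherwise [x] could be added to [b], giving the extension excluded by [no_ext]. *)
have VS x : subspace_exp V n.+1 x -> S x.
  move=> Vx; apply: contrapT => Sx.
  apply: (no_ext (fun i => if unlift ord0 i is Some j then b j else x)).
  split=> [i|f fF]; first by case: unliftP => [j _|_].
  rewrite big_ord_recl unlift_none.
  under eq_bigr do rewrite liftK.
  have [f0|f0] := eqVneq (f ord0) 0.
    rewrite f0 mul0r add0r => /b_free f1 i.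
    by case: (unliftP ord0 i) => [j ->|->//]; apply: f1 => k.
  move=> /eqP; rewrite addr_eq0 => /eqP fx; case: Sx.
  exists (fun i => - ((f ord0)^-1 * f (lift ord0 i))); split=> [i|].
    rewrite -[- _]addr0 -scaleN1r; apply: FD => //; apply: FM => //.
    exact: centralizerV.
  apply: (mulrI (Q_div _ f0)); rewrite fx mulr_sumr -sumrN.
  apply: eq_bigr => i _.
  by rewrite mulNr mulrN !mulrA divrr ?Q_div// mul1r.
have S1 : S 1 by apply: VS; exact: mem1_subspace_exp.
have SV x v : S x -> V v -> S (x * v).
  move=> [f [fF fE]] Vv.
  (* One more factor from [V] moves [b i] from the power [n] to the power [n.+1], which lies in
     [S]. *)
  have Sbv i : S (b i * v).
    apply: VS; rewrite -addn1; apply: subspace_expM => //.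
    exact: subspace_exp1.
  have [g gP] := choice Sbv.
  exists (fun j => \sum_i f i * g i j); split=> [j|].
    elim/big_ind: _ => // [u w uF wF|i _]; first by rewrite -[u]scale1r; exact: FD.
    by apply: FM => //; have [] := gP i.
  rewrite rmorphM /= fE mulr_suml; under [RHS]eq_bigr do rewrite mulr_suml.
  rewrite exchange_big; apply: eq_bigr => i _.
  rewrite -mulrA -rmorphM /=; have [_ ->] := gP i.
  by rewrite mulr_sumr; apply: eq_bigr => j _; rewrite mulrA.
have SA x y : S x -> S (x * y).
  have : [set: A] y by [].
  (* The right multipliers preserving [S] form a subalgebra containing [V], hence are all of [A]. *)
  rewrite -VA => /(_ [set z | forall u, S u -> S (u * z)]); apply.
  split; last by move=> v Vv u Su; exact: SV.
  apply/subalgebraP; split=> [u|c u v uS vS w Sw|u v uS vS w Sw] /=.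
  - by rewrite mulr1.
  - by rewrite mulrDr -scalerAr; apply: SD; [exact: uS|exact: vS].
  - by rewrite mulrA; apply: vS; exact: uS.
apply: (algebraic_of_finite_span Q_quotient (e := fun i => iota (b i))) => x.
by rewrite -[x]mul1r; exact: SA.
Qed.

Lemma ldim_centralizer_growth (a : A) (V W : set A) :
  generating_subspace V [set: A] -> ~ algebraic_over_center (iota a) ->
  fin_dim W -> W `<=` centralizer a ->
  exists M, (0 < M)%N /\ forall n,
    (n.+1 * ldim (subspace_exp W n) <= ldim (subspace_exp V (M * n)))%N.
Proof.
move=> V_gen a_tr W_fin WC; have [V_fin V1 _] := V_gen.
have [_ iota_inj _] := Q_quotient.
have [m Wm] : exists m, W `<=` subspace_exp V m.
  apply: subspace_exp_absorb => //.
  by rewrite -(generating_subspace_exp V_gen).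
(* The basis of the [n]-th power of [W] costs [m * n] factors from [V], and the free family [b]
   costs [n] more. *)
exists m.+1; split=> // n.
have [b [bV b_free]] := free_over_centralizer_exists n V_gen a_tr.
have [w [w_free WE]] := ldimP (fin_dim_subspace_exp n W_fin).
set d := ldim _ in w w_free WE *.
have Ww i : subspace_exp W n (w i) by rewrite WE; apply: sub_lspan; exists i.
have wC i : centralizer a (w i).
  by apply: subspace_exp_sub (Ww i) => //; exact: centralizer_subalgebra.
suff : (#|{: 'I_n.+1 * 'I_d}| <= ldim (subspace_exp V (m.+1 * n)))%N.
  by rewrite card_prod !card_ord.
apply: (@card_le_ldim _ _ _ (fun p => w p.2 * b p.1)) => [|c c0 [j i]|[j i]/=].
- exact: fin_dim_subspace_exp.
(* Grouped by [j], the relation has coefficients in the centralizer; these vanish by freeness of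
   [b], and then each [c] does by freeness of [w]. *)
- apply: (w_free (fun i => c (j, i))); apply: iota_inj; rewrite rmorph0.
  apply: (b_free (fun j => iota (\sum_i c (j, i) *: w i))) => [k|].
    rewrite /centralizer /= -!rmorphM; congr (iota _).
    rewrite mulr_suml mulr_sumr; apply: eq_bigr => l _.
    by rewrite -scalerAl -scalerAr wC.
  rewrite -[RHS](rmorph0 iota) -[in RHS]c0 rmorph_sum/=.
  rewrite (eq_bigr (fun p => iota (c (p.1, p.2) *: (w p.2 * b p.1)))); last first.
    by case.
  rewrite -(pair_bigA _ (fun j i => iota (c (j, i) *: (w i * b j)))) /=.
  apply: eq_bigr => k _; rewrite -rmorphM mulr_suml rmorph_sum.
  by apply: eq_bigr => l _; rewrite scalerAl.
- rewrite mulSn addnC; apply: subspace_expM => //.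
  exact: subspace_exp_exp Wm _ (Ww i).
Qed.

End Growth.

(** * From growth exponents to Gelfand-Kirillov dimension *)

Section GKdimBound.
Variables (R : realType) (K : fieldType) (A : algType K).
Implicit Types B C V W : set A.

Lemma GKdim_fg_exp B : fin_gen B ->
  exists V, generating_subspace V B /\ GKdim_fg R B = growth_exponent R V.
Proof.
move=> [V V_gen].
have := @xgetPex _ 0%E
  [set growth_exponent R V | V in [set V | generating_subspace V B]].
by case=> [|W W_gen WE]; [exists (growth_exponent R V), V|exists W].
Qed.

(** This treats both branches of [GKdim] together: a generating subspace of any subalgebra of [B]
    lies in [B]. *)
Lemma GKdim_le B (x : \bar R) :
  (forall W, fin_dim W -> W 1 -> W `<=` B -> (growth_exponent R W <= x)%E) ->
  (GKdim R B <= x)%E.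
Proof.
move=> Bx.
have fg_le C : fin_gen C -> C `<=` B -> (GKdim_fg R C <= x)%E.
  move=> /GKdim_fg_exp[W [W_gen ->]] CB; have [W_fin W1 _] := W_gen.
  by apply: Bx => //; apply: subset_trans CB; exact: generating_subspace_sub.
rewrite /GKdim; case: asboolP => [B_fg|_]; first exact: fg_le.
by apply: ge_ereal_sup => _ [C [C_fg CB] <-]; exact: fg_le.
Qed.

End GKdimBound.

Theorem theorem1p1 (R : realType) (K : fieldType) (A : algType K)
    (A_domain : domain A)
    (A_fin_gen : fin_gen [set: A])
    (A_GK_finite : (GKdim R [set: A] < +oo)%E)
    (Q : unitAlgType K) (iota : {lrmorphism A -> Q})
    (Q_quotient : quotient_division_algebra iota)
    (a : A) (a_transcendental : ~ algebraic_over_center (iota a)) :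
  (GKdim R (centralizer a) <= GKdim R [set: A] - 1)%E.
Proof.
have [V [V_gen VE]] := GKdim_fg_exp R A_fin_gen.
rewrite [X in (_ <= X - 1)%E](_ : _ = growth_exponent R V); last first.
  by rewrite /GKdim -VE; case: asboolP.
apply: GKdim_le => W W_fin W1 WC.
have [M [M0 WV]] :=
  ldim_centralizer_growth Q_quotient V_gen a_transcendental W_fin WC.
apply: (limn_esup_log_ratio R M0) => [n|n]; last exact: WV.
(* The powers of [W] have positive dimension because they contain 1. *)
rewrite -(card_ord 1).
apply: (@card_le_ldim _ _ _ (fun=> 1)) => [|c|_].
- exact: fin_dim_subspace_exp.
- rewrite big_ord1 => /eqP; rewrite scaler_eq0 oner_eq0 orbF => /eqP c0 i.
  by rewrite ord1.
- exact: mem1_subspace_exp.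
Qed.
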